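(* Let $G=(V,E)$ be a finite simple undirected graph whose node set is partitioned into a set $\mathcal{C}$ of (nonempty) categories, let $A,B\in\mathcal{C}$ with $A\neq B$, let $\mathrm{w}:V\to(0,\infty)$ be known sampling weights on nodes, and let $S$ be a weighted independence sample of size $n$ from $V$ with weights $\mathrm{w}$. Then the weighted induced-subgraph estimator of the category edge weight $$\widehat{\mathrm{w}}(A,B)=\frac{\sum_{a\in S_A}\sum_{b\in S_B}\frac{1_{\{\{a,b\}\in E\}}}{\mathrm{w}(a)\cdot\mathrm{w}(b)}}{\mathrm{w}_{-1}(S_A)\cdot\mathrm{w}_{-1}(S_B)}$$ is consistent for the category edge weight $\mathrm{w}(A,B)=\dfrac{|E_{A,B}|}{|A|\cdot|B|}$, i.e. $\widehat{\mathrm{w}}(A,B)\to\mathrm{w}(A,B)$ in probability as $n\to\infty$.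
   Context: $\mathrm{w}(v)$ (one node argument) is a sampling weight, whereas $\mathrm{w}(A,B)$ (two category arguments) is the category edge weight; they are unrelated functions. $E_{A,B}=\{\{u,v\}\in E: u\in A,\ v\in B\}$ is the edge-cut between $A$ and $B$. Weighted independence sampling (WIS): $X_1,X_2,\dots$ are i.i.d. random nodes (sampling with replacement) with $P(X_i=v)=\pi(v)=\mathrm{w}(v)/\sum_{u\in V}\mathrm{w}(u)$, and $S$ is the multiset $\{X_1,\dots,X_n\}$; all sums over sub-multisets of $S$ count multiplicity. For a category $C$, $S_C=\{v\in S: v\in C\}$. For a multiset $X$ of nodes, $\mathrm{w}_{-1}(X)=\sum_{v\in X}\frac{1}{\mathrm{w}(v)}$. Any ratio whose denominator is zero is assigned the value $0$. $G$ and the weights are fixed. *)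

(* Defs.v *)
From mathcomp Require Import all_boot all_order all_algebra.
From mathcomp Require Import all_classical all_reals all_analysis.

Set Implicit Arguments.
Unset Strict Implicit.
Unset Printing Implicit Defensive.

Import Order.TTheory GRing.Theory Num.Theory.
Import numFieldNormedType.Exports.

Local Open Scope ring_scope.

(* A finite simple undirected graph on V is given by its set E of edges, each
   edge being a two-element set of nodes. *)
Definition is_simple_graph (V : finType) (E : {set {set V}}) : Prop :=
  forall f : {set V}, f \in E -> #|f| = 2%N.

Definition edge_cut (V : finType) (E : {set {set V}}) (A B : {set V}) :
  {set {set V}} :=
  [set f in E | [exists u in A, exists v in B, f == [set u; v]%SET]]%SET.

Definition category_edge_weight (R : realType) (V : finType)
  (E : {set {set V}}) (A B : {set V}) : R :=
  #|edge_cut E A B|%:R / (#|A|%:R * #|B|%:R).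

(* Finite multisets of nodes are represented by sequences: sums over them count
   multiplicities and do not depend on the order. *)

Definition in_category (V : finType) (S : seq V) (C : {set V}) : seq V :=
  [seq v <- S | v \in C].

Definition inv_weight (R : realType) (V : finType) (w : V -> R) (S : seq V)
  : R :=
  \sum_(v <- S) (w v)^-1.

(* Division by zero yields 0, since 0^-1 = 0 in a field of the library. *)
Definition edge_weight_estimator (R : realType) (V : finType)
  (E : {set {set V}}) (w : V -> R) (A B : {set V}) (S : seq V) : R :=
  (\sum_(a <- in_category S A) \sum_(b <- in_category S B)
     ([set a; b]%SET \in E)%:R / (w a * w b))
  / (inv_weight w (in_category S A) * inv_weight w (in_category S B)).

Local Open Scope classical_set_scope.

Definition mutually_independent d (T : measurableType d) (R : realType)
  (P : probability T R) (V : finType) (X : nat -> T -> V) : Prop :=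
  forall (J : seq nat) (B : nat -> set V), uniq J ->
    P (\bigcap_(i in [set` J]) (X i @^-1` B i)) =
    (\prod_(i <- J) P (X i @^-1` B i))%E.

(* The finite set V carries the discrete sigma-algebra, for which measurability
   of X i amounts to measurability of its fibres.  The indices start from 0. *)
Definition weighted_independence_sampling d (T : measurableType d)
  (R : realType) (P : probability T R) (V : finType) (w : V -> R)
  (X : nat -> T -> V) : Prop :=
  [/\ forall i v, measurable (X i @^-1` [set v]),
      forall i v, P (X i @^-1` [set v]) = (w v / \sum_(u : V) w u)%:E
    & mutually_independent P X].

Definition sample (T : Type) (V : finType) (X : nat -> T -> V) (n : nat)
  (t : T) : seq V :=
  [seq X i t | i <- iota 0 n].

Definition cvg_in_probability d (T : measurableType d) (R : realType)
  (P : probability T R) (Y : nat -> T -> R) (y : R) : Prop :=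
  (forall n, measurable_fun [set: T] (Y n)) /\
  (forall eps : R, 0 < eps ->
     P [set t | eps < `|Y n t - y|] @[n --> \oo] --> 0%E).

(* Main.v *)
(* The estimator is a function of the numbers of occurrences of the nodes in the
   sample, and it is invariant under scaling of these numbers, hence a function
   of the frequencies.  By the weak law of large numbers the frequency of v
   tends to w v / \sum_u w u in probability; the factor w v cancels the inverse
   weights, so that continuity of the ratio gives the limit.  Convergence in
   probability is handled as convergence along a filter on pairs (n, t), so that
   the library's limit theorems for arithmetic operations apply to it. *)

Require Import Defs.
From mathcomp Require Import all_boot all_order all_algebra.
From mathcomp Require Import all_classical all_reals all_analysis.
From mathcomp Require Import measurable_realfun.

Set Implicit Arguments.
Unset Strict Implicit.
Unset Printing Implicit Defensive.

Import Order.TTheory GRing.Theory Num.Theory.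
Import numFieldNormedType.Exports.

Local Open Scope ring_scope.

(** * Algebra of the estimator and counting of the edge-cut *)

Lemma big_count_mem (R : pzSemiRingType) (V : finType) (s : seq V) (C : {set V})
    (g : V -> R) :
  \sum_(x <- s | x \in C) g x = \sum_(v in C) (count_mem v s)%:R * g v.
Proof.
elim: s => [|x s IHs].
  by rewrite big_nil big1// => v _; rewrite mul0r.
rewrite big_cons; under [RHS]eq_bigr do rewrite /= natrD mulrDl.
rewrite big_split/= -IHs big_mkcond/= [X in _ = X + _]big_mkcond/=.
rewrite [X in _ = X + _](bigD1 x)//= eqxx mul1r.
rewrite [X in _ = _ + X + _]big1 ?addr0; last first.
  by move=> v vx; rewrite eq_sym (negbTE vx) mul0r; case: ifP.
by case: ifP => // _; rewrite add0r.
Qed.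

(* x v stands for the number, or the frequency, of the occurrences of v in the
   sample. *)
Definition weighted_ratio (R : realType) (V : finType) (E : {set {set V}})
    (w : V -> R) (A B : {set V}) (x : V -> R) : R :=
  (\sum_(a in A) \sum_(b in B)
     x a * (x b * (([set a; b]%SET \in E)%:R / (w a * w b))))
  / ((\sum_(a in A) x a * (w a)^-1) * (\sum_(b in B) x b * (w b)^-1)).

Section weighted_ratio.
Variables (R : realType) (V : finType) (E : {set {set V}}) (w : V -> R).
Variables (A B : {set V}).

Lemma edge_weight_estimatorE (s : seq V) :
  edge_weight_estimator E w A B s =
  weighted_ratio E w A B (fun v => (count_mem v s)%:R).
Proof.
rewrite /edge_weight_estimator /inv_weight /in_category !big_filter.
rewrite !(big_count_mem s); congr (_ / _); apply: eq_bigr => a _.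
by rewrite big_filter (big_count_mem s) mulr_sumr.
Qed.

(** Numerator and denominator are both homogeneous of degree 2 in [x]. This serves twice: to pass
    from counts to frequencies, and to remove the normalising constant of the sampling distribution
    from the limit. *)
Lemma weighted_ratio_scale (c : R) (x : V -> R) : c != 0 ->
  weighted_ratio E w A B (fun v => c * x v) = weighted_ratio E w A B x.
Proof.
move=> c0; rewrite /weighted_ratio.
have lin (C : {set V}) (g : V -> R) :
    \sum_(a in C) c * x a * g a = c * \sum_(a in C) x a * g a.
  by rewrite mulr_sumr; apply: eq_bigr => a _; rewrite mulrA.
rewrite !lin.
rewrite [X in X / _ = _](_ : _ = c * c *
    \sum_(a in A) \sum_(b in B)
      x a * (x b * (([set a; b]%SET \in E)%:R / (w a * w b)))); last first.
  rewrite -mulrA 2!mulr_sumr; apply: eq_bigr => a _.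
  rewrite 2!mulr_sumr; apply: eq_bigr => b _.
  by rewrite -[c * x b * _]mulrA !mulrA [c * x a * c]mulrAC.
by rewrite mulrACA -mulf_div divff ?mulf_neq0// mul1r.
Qed.

End weighted_ratio.

(** Disjointness makes the map from a pair [(a, b)] to the set of its entries injective on the
    product of [A] and [B], so each edge of the cut arises from exactly one pair. *)
Lemma card_edge_cut (V : finType) (E : {set {set V}}) (A B : {set V}) :
  [disjoint A & B] ->
  #|edge_cut E A B| =
  (\sum_(a in A) \sum_(b in B) ([set a; b]%SET \in E))%N.
Proof.
move=> dAB; pose f (p : V * V) := [set p.1; p.2]%SET.
have injf : {in finset.setX A B &, injective f}.
  move=> [a b] [a' b'] /[!inE]/= /andP[aA bB] /andP[a'A b'B] /setP ff.
  have nAB u v : u \in A -> v \in B -> (u == v) = false.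
    by move=> uA vB; apply: contraTF uA => /eqP ->; rewrite (disjointFl dAB).
  (* [a] is one of [a'] and [b'], and [nAB] excludes [b']; similarly [b] cannot be [a']. *)
  have := ff a; have := ff b; rewrite !inE !eqxx/= orbT (nAB _ _ aA b'B) orbF.
  rewrite [b == a']eq_sym (nAB _ _ a'A bB)/=.
  by move=> /esym/eqP -> /esym/eqP ->.
transitivity #|f @: [set p in finset.setX A B | f p \in E]|.
  congr (#|pred_of_set _|); apply/setP => g; rewrite !inE; apply/andP/imsetP.
    move=> [gE /exists_inP[a aA /exists_inP[b bB /eqP gab]]].
    by exists (a, b) => //; rewrite !inE aA bB/= /f -gab.
  move=> [[a b]] /[!inE]/= /andP[/andP[aA bB] abE] ->; split => //.
  by apply/exists_inP; exists a => //; apply/exists_inP; exists b.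
rewrite card_in_imset; last first.
  by move=> p q /[!inE] /andP[pAB _] /andP[qAB _]; apply: injf; rewrite inE.
rewrite pair_big/= -sum1_card big_mkcond [RHS]big_mkcond/=.
by apply: eq_bigr => -[a b] _; rewrite !inE/=;
  case: (_ \in A) (_ \in B) (_ \in E) => [] [] [].
Qed.

(** * Convergence in probability as convergence along a filter *)

Local Open Scope classical_set_scope.

(* A set of pairs (n, t) belongs to the filter if its sections have inner
   probability tending to 1. *)
Definition prob_cvg_filter d (T : measurableType d) (R : realType)
    (P : probability T R) : set_system (nat * T) :=
  [set Q | exists M : nat -> set T, [/\ forall n, measurable (M n),
     P (M n) @[n --> \oo] --> 0%E & forall n t, ~ M n t -> Q (n, t)]].

Section prob_cvg_filter.
Context d (T : measurableType d) (R : realType) (P : probability T R).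

(** Stability under intersection is the union bound for the exceptional sets. *)
Global Instance prob_cvg_filter_filter : Filter (prob_cvg_filter P).
Proof.
split.
- exists (fun=> set0); split => //.
  by apply: cvg_near_cst; apply: nearW => n; rewrite measure0.
- move=> Q Q' [M [mM M0 MQ]] [M' [mM' M'0 MQ']].
  exists (fun n => M n `|` M' n); split.
  + by move=> n; exact: measurableU.
  + apply: (@squeeze_cvge _ _ _ _ (cst 0%E) _ (fun n => P (M n) + P (M' n))%E).
    * by apply: nearW => n; rewrite measure_ge0/= measureU2.
    * exact: cvg_cst.
    * by rewrite -[X in _ --> X]adde0; apply: cvgeD.
  + by move=> n t /not_orP[nM nM']; split; [exact: MQ|exact: MQ'].
- move=> Q Q' QQ' [M [mM M0 MQ]]; exists M; split => // n t nM.
  exact/QQ'/MQ.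
Qed.

Lemma cvg_in_probabilityP (Y : nat -> T -> R) (y : R) :
  (forall n, measurable_fun [set: T] (Y n)) ->
  Y z.1 z.2 @[z --> prob_cvg_filter P] --> y -> cvg_in_probability P Y y.
Proof.
move=> mY cY; split=> // e e0.
(* The non-strict criterion is chosen because its negation is the strict inequality of
   [cvg_in_probability]: the deviation event then lies in [M n]. *)
have /cvgrPdist_le/(_ _ e0)[M [mM M0 MY]] := cY.
apply: (@squeeze_cvge _ _ _ _ (cst 0%E) _ (fun n => P (M n))) => //.
  apply: nearW => n; rewrite measure_ge0/= le_measure ?inE//.
    rewrite [X in measurable X](_ : _ =
        (fun t => `|Y n t - y|) @^-1` `]e, +oo[).
      rewrite -[_ @^-1` _]setTI.
      have : measurable_fun [set: T] (fun t => `|Y n t - y|).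
        by apply: measurableT_comp => //; exact: measurable_funD.
      by apply.
    by apply/seteqP; split => t /=; rewrite in_itv/= andbT.
  move=> t /= et; apply: contrapT => /MY/=.
  by rewrite distrC leNgt et.
exact: cvg_cst.
Qed.

End prob_cvg_filter.

(** * Weak law of large numbers for pairwise independent events of equal probability *)

Section weak_law_of_events.
Context d (T : measurableType d) (R : realType) (P : probability T R).

Lemma Lfun_indic (D : set T) (r : R) : 1 <= r -> measurable D ->
  (\1_D : T -> R) \in Lfun P r%:E.
Proof.
move=> r1 mD; rewrite inE/=; apply/andP; split; rewrite inE//=.
rewrite /finite_norm unlock poweR_lty//.
under eq_integral => x _.
  rewrite /= (_ : `|\1_D x| `^ r = \1_D x); last first.
    rewrite indicE; case: (_ \in _); rewrite ?normr1 ?powR1// normr0 powR0//.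
    by rewrite gt_eqF// (lt_le_trans ltr01).
  over.
by rewrite integral_indic// (le_lt_trans (probability_le1 _ _)) ?ltry// setIT.
Qed.

Lemma covariance_indic (D D' : set T) : measurable D -> measurable D' ->
  covariance P \1_D \1_D' = (P (D `&` D') - P D * P D')%E.
Proof.
move=> mD mD'; have mDD' := measurableI _ _ mD mD'.
have DD' : (\1_D * \1_D' : T -> R) = \1_(D `&` D') by rewrite indicI.
by rewrite covarianceE ?DD' ?Lfun_indic// !expectation_indic.
Qed.

Variables (C : nat -> set T) (p : R).
Hypothesis mC : forall i, measurable (C i).
Hypothesis PC : forall i, P (C i) = p%:E.
Hypothesis indepC : forall i j, i != j -> P (C i `&` C j) = (p ^+ 2)%:E.

Let S n : T -> R := \sum_(i < n) \1_(C i).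

Let S2 n : S n \in Lfun P 2%:E.
Proof.
have l1 : (1 <= 2%:E :> \bar R)%E by rewrite lee1n.
by apply: rpred_sum => i _; rewrite Lfun_indic// ler1n.
Qed.

Lemma expectation_sum_indic n : ('E_P[S n] = (n%:R * p)%:E)%E.
Proof.
rewrite /S; elim: n => [|n IHn].
  by rewrite big_ord0 mul0r expectation_cst.
rewrite big_ord_recr/= expectationD ?Lfun_indic//; last first.
  by apply: rpred_sum => i _; exact: Lfun_indic.
by rewrite IHn expectation_indic// PC -EFinD -natr1 mulrDl mul1r.
Qed.

(** Pairwise independence makes distinct indicators uncorrelated, so their variances add up, each
    being [p - p ^+ 2]. *)
Lemma variance_sum_indic n : ('V_P[S n] = (n%:R * (p - p ^+ 2))%:E)%E.
Proof.
have i2 i : (\1_(C i) : T -> R) \in Lfun P 2%:E.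
  by apply: Lfun_indic => //; rewrite ler1n.
have SS m : S m.+1 = S m \+ \1_(C m) by rewrite /S big_ord_recr.
(* The index [k] is kept apart from [m] so that it stays fixed in the induction on [m]; the case
   used below is [k = m]. *)
have cov m k : (m <= k)%N -> covariance P (S m) \1_(C k) = 0%E.
  elim: m => [_|m IHm mk].
    by rewrite /S big_ord0 covariance_cst_l.
  rewrite SS covarianceDl// IHm ?(ltnW mk)// add0e covariance_indic//.
  by rewrite indepC ?ltn_eqF// !PC -EFinM -EFinB expr2 subrr.
elim: n => [|n IHn].
  by rewrite /S big_ord0 mul0r variance_cst.
rewrite SS varianceD// IHn cov// mule0 adde0 /variance covariance_indic//.
by rewrite setIid !PC -EFinM -EFinB -EFinD expr2 -natr1 mulrDl mul1r.
Qed.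

(** Chebyshev's inequality bounds the probability of a deviation of at least [e] by a constant over
    the number of events. *)
Lemma weak_law_of_events :
  z.1%:R^-1 * (\sum_(i < z.1) \1_(C i)) z.2 @[z --> prob_cvg_filter P] --> p.
Proof.
apply/cvgrPdist_lt => e e0.
have mS n : measurable_fun [set: T] (S n).
  by have /sub_Lfun_mfun := S2 n; rewrite inE.
pose M n := [set t | e <= `|n%:R^-1 * S n t - p|].
exists M; split.
- move=> n; rewrite [X in measurable X](_ : _ =
      (fun t => `|n%:R^-1 * S n t - p|) @^-1` `[e, +oo[); last first.
    by apply/seteqP; split => t /=; rewrite in_itv/= andbT.
  rewrite -[_ @^-1` _]setTI.
  have : measurable_fun [set: T] (fun t => `|n%:R^-1 * S n t - p|).
    apply: measurableT_comp => //.
    apply: measurable_funD => //.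
    exact: measurable_funM.
  by apply.
(* The shift avoids division by the sample size 0 and fits [harmonic n], which is the inverse of
   [n.+1]. *)
- suff cM : P (M n.+1) @[n --> \oo] --> 0%E.
    by rewrite -(cvg_shiftS (fun n => P (M n))); exact: cM.
  (* With [N] for [n.+1], the Chebyshev bound is [N * (p - p ^+ 2)] over [(N * e) ^+ 2], that is,
     [c / N]. *)
  pose c : R := e ^- 2 * (p - p ^+ 2).
  apply: (@squeeze_cvge _ \oo _ R (cst 0%E) (fun n => P (M n.+1))
    (fun n => (c * harmonic n : R)%:E)).
  + apply: nearW => n /=; rewrite measure_ge0/=.
    have n0 : (0 : R) < n.+1%:R by rewrite ltr0n.
    have -> : M n.+1 =
        [set t | n.+1%:R * e <= `|S n.+1 t - n.+1%:R * p|].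
      apply/funext => t; rewrite /M/= -[in LHS](ler_pM2l n0).
      rewrite -[X in X * `|_|](gtr0_norm n0) -normrM mulrBr.
      by rewrite mulVKf// gt_eqF.
    pose Sn : {RV P >-> R} := mfun_Sub (mem_set (mS n.+1)).
    have := @chebyshev _ _ _ P Sn (n.+1%:R * e) (mulr_gt0 n0 e0).
    rewrite -[Sn : T -> R]/(S n.+1) variance_sum_indic.
    rewrite expectation_sum_indic/=.
    rewrite -EFinM (_ : _ ^- 2 * _ = c * harmonic n); last first.
      rewrite /c exprMn invfM mulrACA mulrC; congr (_ * _).
      by rewrite expr2 invfM mulfVK ?gt_eqF.
    exact.
  + exact: cvg_cst.
  + apply: cvg_EFin; first exact: nearW.
    by rewrite -[X in _ --> X](mulr0 c); apply: cvgMr; exact: cvg_harmonic.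
- by move=> n t /negP; rewrite -ltNge distrC.
Qed.

End weak_law_of_events.

(** * Continuity of the ratio *)

Lemma cvg_weighted_ratio (R : realType) (V : finType) (E : {set {set V}})
    (w : V -> R) (A B : {set V}) (U : Type) (F : set_system U) (FF : Filter F)
    (f : V -> U -> R) (x : V -> R) :
  (forall v, f v u @[u --> F] --> x v) ->
  (\sum_(a in A) x a * (w a)^-1) * (\sum_(b in B) x b * (w b)^-1) != 0 ->
  weighted_ratio E w A B (f^~ u) @[u --> F] --> weighted_ratio E w A B x.
Proof.
move=> fx x0.
have cvgS (C : {set V}) (g : V -> U -> R) (l : V -> R) :
    (forall v, g v u @[u --> F] --> l v) ->
    \sum_(v in C) g v u @[u --> F] --> \sum_(v in C) l v.
  move=> gl; apply: (@cvg_big _ _ _ _ (mem C) _ _ F) => //.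
  exact: add_continuous.
apply: cvgM.
  apply: (cvgS _ (fun a u => _)) => a; apply: (cvgS _ (fun b u => _)) => b.
  by apply: cvgM => //; apply: cvgM => //; exact: cvg_cst.
apply: cvgV => //; apply: cvgM.
  by apply: (cvgS _ (fun a u => _)) => a; apply: cvgM => //; exact: cvg_cst.
by apply: (cvgS _ (fun b u => _)) => b; apply: cvgM => //; exact: cvg_cst.
Qed.

(** * Counts, measurability and frequencies in the sample *)

Section sample.
Context (T : Type) (V : finType) (X : nat -> T -> V).

Lemma sampleS n t : sample X n.+1 t = rcons (sample X n t) (X n t).
Proof. by rewrite /sample -addn1 iotaD map_cat cats1. Qed.

Lemma count_sample (R : realType) v n t :
  (count_mem v (sample X n t))%:R =
  (\sum_(i < n) \1_(X i @^-1` [set v])) t :> R.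
Proof.
elim: n => [|n IHn]; first by rewrite big_ord0.
rewrite sampleS -cats1 count_cat natrD IHn big_ord_recr/= addn0.
rewrite -[RHS]/(_ + \1_(X n @^-1` [set v]) t) indicE.
by congr (_ + (nat_of_bool _)%:R); apply/eqP/idP; rewrite inE.
Qed.

End sample.

(** The event is split according to the value of the last draw, which gives a finite union. The set
    [D] varies in the induction, since it has to absorb that value. *)
Lemma measurable_sample d (T : measurableType d) (V : finType)
    (X : nat -> T -> V) n (D : set (seq V)) :
  (forall i v, measurable (X i @^-1` [set v])) ->
  measurable (sample X n @^-1` D).
Proof.
move=> mX; elim: n D => [|n IHn] D.
  by have [D0|D0] := pselect (D [::]);
    [rewrite (_ : _ @^-1` _ = setT)|rewrite (_ : _ @^-1` _ = set0)] => //;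
    apply/seteqP; split.
rewrite (_ : _ @^-1` _ = \bigcup_(v : V)
    (X n @^-1` [set v] `&` sample X n @^-1` [set s | D (rcons s v)])).
  apply: fin_bigcup_measurable => // v _.
  by apply: measurableI => //; exact: IHn.
apply/seteqP; split => t /=; rewrite sampleS.
  by move=> Dt; exists (X n t).
by move=> [v _ [/= -> ]].
Qed.

Lemma cvg_sample_frequency (R : realType) (V : finType) (w : V -> R)
    d (T : measurableType d) (P : probability T R) (X : nat -> T -> V) (v : V) :
  weighted_independence_sampling P w X ->
  z.1%:R^-1 * (count_mem v (sample X z.1 z.2))%:R @[z --> prob_cvg_filter P]
    --> w v / \sum_(u : V) w u.
Proof.
move=> [mX PX iX]; under eq_cvg do rewrite count_sample.
apply: (weak_law_of_events (C := fun i => X i @^-1` [set v])) => // i j ij.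
(* Mutual independence is applied to two draws, both required to equal [v]. *)
have := iX [:: i; j] (fun=> [set v]).
rewrite /= inE ij => /(_ isT).
rewrite !big_cons big_nil mule1 !PX -EFinM -expr2 => <-; congr (P _).
apply/seteqP; split => [t [ti tj] k /=|t tij].
  by rewrite !inE => /orP[] /eqP ->.
by split; apply: tij => /=; rewrite !inE eqxx ?orbT.
Qed.

(* Consistency of the estimator *)
Local Close Scope classical_set_scope.

Theorem mainTheorem7 (R : realType) (V : finType) (E : {set {set V}})
    (cats : {set {set V}}) (A B : {set V}) (w : V -> R)
    (d : measure_display) (T : measurableType d) (P : probability T R)
    (X : nat -> T -> V)
    (hE : is_simple_graph E)
    (hcats : finset.partition cats [set: V]%SET)
    (hA : A \in cats) (hB : B \in cats) (hAB : A != B)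
    (hw : forall v, 0 < w v)
    (hX : weighted_independence_sampling P w X) :
  cvg_in_probability P
    (fun n t => edge_weight_estimator E w A B (sample X n t))
    (category_edge_weight R E A B).
Proof.
have [_ tI n0] := and3P hcats.
have dAB : [disjoint A & B] by move/finset.trivIsetP : tI; apply.
have nonempty C : C \in cats -> exists v, v \in C.
  by move=> hC; apply/finset.set0Pn; apply: contraNneq n0 => <-.
have w0 v : w v != 0 by rewrite gt_eqF.
have sum_cst (C : {set V}) : \sum_(v in C) w v * (w v)^-1 = #|C|%:R.
  by under eq_bigr do rewrite divff//; rewrite sumr_const.
have card0 C : C \in cats -> #|C|%:R != 0 :> R.
  by move=> /nonempty[v vC]; rewrite pnatr_eq0 -lt0n; apply/card_gt0P; exists v.
pose W := \sum_(u : V) w u.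
(* The total weight is positive because the category [A] contains a node. *)
have W0 : W^-1 != 0.
  have [v _] := nonempty _ hA.
  rewrite invr_eq0 gt_eqF// /W (bigD1 v)//= ltr_pwDl// sumr_ge0// => u _.
  exact: ltW.
pose freq v (z : nat * T) : R :=
  z.1%:R^-1 * (count_mem v (sample X z.1 z.2))%:R.
have estE z : edge_weight_estimator E w A B (sample X z.1 z.2) =
    weighted_ratio E w A B (freq^~ z).
  rewrite edge_weight_estimatorE /freq; case: z => [[|n] t]/=.
    (* n = 0: the sample is empty and 0^-1 = 0. *)
    by congr weighted_ratio; apply/funext => v; rewrite mulr0.
  by rewrite weighted_ratio_scale// invr_eq0 pnatr_eq0.
have limE : weighted_ratio E w A B (fun v => w v / W) =
    category_edge_weight R E A B.
  (* Once [W^-1] is scaled out, the weights cancel: the denominator becomes the product of the two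
     cardinalities and the numerator counts the adjacent pairs. *)
  under [X in weighted_ratio _ _ _ _ X]eq_fun do rewrite mulrC.
  rewrite weighted_ratio_scale// /weighted_ratio !sum_cst /category_edge_weight.
  congr (_ / _); rewrite card_edge_cut// natr_sum; apply: eq_bigr => a _.
  rewrite natr_sum; apply: eq_bigr => b _.
  by rewrite mulrA mulrC divfK ?mulf_neq0.
apply: cvg_in_probabilityP.
  move=> n _ D _; rewrite setTI.
  have [mX _ _] := hX.
  exact: (measurable_sample n
    (edge_weight_estimator E w A B @^-1` D)%classic mX).
under eq_cvg do rewrite estE.
rewrite -limE; apply: cvg_weighted_ratio.
  by move=> v; exact: cvg_sample_frequency.
(* The limit of the denominator is nonzero because both categories are nonempty. *)
have lin (C : {set V}) : \sum_(v in C) w v / W * (w v)^-1 = #|C|%:R / W.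
  by rewrite -sum_cst mulr_suml; apply: eq_bigr => v _; rewrite mulrAC.
by rewrite !lin !mulf_neq0 ?card0.
Qed.
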